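(* Let $N\ge 1$ be an integer and $0<p\le 1$. Then the equation $$\Delta^2u=-u^{-p}\quad\text{in }\mathbb{R}^N$$ admits no entire smooth solution, i.e. there is no positive function $u\in C^4(\mathbb{R}^N)$ satisfying this equation at every point of $\mathbb{R}^N$.
   Context: A smooth (or classical) solution of $\Delta^{2}u=f(u)$ means a solution of class $C^{4}$. Solutions of $\Delta^2u=-u^{-p}$ are understood to be positive functions, so that $u^{-p}$ is defined. ''Entire'' means defined on all of $\mathbb{R}^N$. *)

(* Defs.v *)
From HB Require Import structures.
From mathcomp Require Import all_boot all_order all_algebra.
From mathcomp Require Import all_classical all_reals all_analysis.

Set Implicit Arguments.
Unset Strict Implicit.
Unset Printing Implicit Defensive.

Import Order.TTheory GRing.Theory Num.Theory.
Import numFieldNormedType.Exports.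

Local Open Scope classical_set_scope.
Local Open Scope ring_scope.

(* R^N is 'rV[R]_N, whose library norm is the sup norm; it induces the
   Euclidean topology. *)

Definition partial (R : realType) (N : nat) (i : 'I_N) (u : 'rV[R]_N -> R) :
  'rV[R]_N -> R := fun x => 'D_('e_i) u x.

(* C^k(R^N): every iterated partial derivative of order <= k exists everywhere
   and is continuous. Existence is required separately because 'D_v is a total
   operator, with a junk value where the directional derivative does not exist. *)
Fixpoint classC (R : realType) (N k : nat) (u : 'rV[R]_N -> R) : Prop :=
  match k with
  | 0%N => continuous u
  | k'.+1 => continuous u /\
      forall i : 'I_N,
        (forall x : 'rV[R]_N, derivable u x 'e_i) /\ classC k' (partial i u)
  end.

Definition laplacian (R : realType) (N : nat) (u : 'rV[R]_N -> R) :
  'rV[R]_N -> R := fun x => \sum_(i < N) partial i (partial i u) x.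

Definition bilaplacian (R : realType) (N : nat) (u : 'rV[R]_N -> R) :
  'rV[R]_N -> R := laplacian (laplacian u).

(* Main.v *)
Require Import Defs.
From HB Require Import structures.
From mathcomp Require Import all_boot all_order all_algebra.
From mathcomp Require Import all_classical all_reals all_analysis.
From mathcomp Require Import ring lra.
Import Order.TTheory GRing.Theory Num.Theory.
Import numFieldNormedType.Exports.
Local Open Scope classical_set_scope.
Local Open Scope ring_scope.


(** Why there is no solution.  Average the equation over balls.  For
    [s > 0] let [A_j(f)(s)] be the mean of [f] for the probability density
    proportional to [(s - |x|^2)_+^j].  Integrating by parts twice against this
    density yields the one identity on which everything rests
    ([is_derive_bump_mean]):
      [d/ds A_j(f)(s) = A_(j+1)(laplacian f)(s) / (2 (2 (j + 1) + N))].
    It plays the role of the formula for the radial derivative of a spherical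
    mean, but needs neither surface measure nor polar coordinates.

    Write [v] for the Laplacian of [u], so that the Laplacian of [v] is
    [- u^(-p)].  Every [A_j(v)] decreases, because [- u^(-p) < 0]; hence
    [A_j(v)] is bounded above, hence [A_j(u)(s) <= K s] for [s >= N + 1].
    Convexity of [t^(-1)] turns this into [A_j(u^(-p))(s) >= 1 / (K s)]; this is
    where [p <= 1] enters ([powR_ge_tangent]).  As [1 / s] is not integrable at
    infinity, [A_j(v)] tends to minus infinity like [- ln s].  Once it is below
    [-1], [A_j(u)] decreases at a definite rate and becomes negative, which
    contradicts [u > 0].

    The only integral needed is a positive linear functional on continuous
    functions that annihilates [d_i F] whenever [F] vanishes on the boundary of
    a large cube ([cube_integral_derive0]).  It is obtained as the limit of
    Riemann sums along an ultrafilter on the integers, so that convergence is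
    free; translating the grid by one step gives the vanishing property.  The
    cube depends on how far [s] has to travel, and the
    functional with it, but means are normalised, so the bounds on [A_j(u)] and
    [A_j(v)] at the initial radius come from the suprema of [u] and [v] over a
    fixed ball and do not depend on the cube. *)

(** * Derivatives along a line and powers of the positive part *)

Lemma is_derive_line {R : realType} {V : normedModType R} (f : V -> R)
    (x v : V) (t d : R) :
  is_derive (x + t *: v) v f d <-> is_derive t 1 (fun h : R => f (x + h *: v)) d.
Proof.
have e : (fun h : R => h^-1 *: ((f \o shift (x + t *: v)) (h *: v) - f (x + t *: v)))
    = (fun h : R => h^-1 *: (((fun h => f (x + h *: v)) \o shift t) (h *: (1:R)) - f (x + t *: v))).
  by apply/funext => h /=; rewrite addrCA -scalerDl [_ *: 1]mulr1.
by split=> -[dr de]; split; move: dr de; rewrite /derivable /derive e.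
Qed.

(** Every derivative computed by hand below (squared norm, powers of a positive
    part, integrals depending on a parameter) comes with a quadratic error bound,
    which replaces a separate limit computation each time. *)
Lemma is_derive_quadratic {R : realType} {V : normedModType R} {f : V -> R}
    {x v : V} {d : R} (C : R) :
  (forall h : R, `|h| <= 1 -> `|f (x + h *: v) - f x - h * d| <= C * h ^+ 2) ->
  is_derive x v f d.
Proof.
move=> H.
have cv : (h^-1 *: ((f \o shift x) (h *: v) - f x)) @[h --> 0^'] --> d.
  have C0 : 0 <= C.
    by have := H 1; rewrite normr1 lexx expr1n mulr1 => /(_ isT); apply: le_trans.
  apply/cvgrPdist_le => e e0; near=> h.
  have h0 : h != 0 by near: h; exact: nbhs_dnbhs_neq.
  have h1 : `|h| <= 1 by near: h; apply: dnbhs0_le.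
  have h2 : `|h| <= e / (C + 1) by near: h; apply: dnbhs0_le; rewrite divr_gt0// ltr_wpDl.
  have := H h h1; rewrite /= (addrC (h *: v)) => Hh.
  rewrite distrC.
  have -> : h^-1 *: (f (x + h *: v) - f x) - d = h^-1 * (f (x + h *: v) - f x - h * d).
    by rewrite mulrBr mulKf.
  rewrite normrM normfV ler_pdivrMl ?normr_gt0//.
  apply: le_trans Hh _; rewrite -real_normK ?num_real// expr2 mulrCA.
  apply: ler_wpM2l => //.
  apply: le_trans (_ : (C + 1) * `|h| <= _); first by apply: ler_wpM2r => //; rewrite lerDl.
  by rewrite mulrC -ler_pdivlMr // ltr_wpDl.
split; last exact: cvg_lim cv.
by apply/cvg_ex; exists d.
Unshelve. all: by end_near. Qed.

(** Factor [b ^+ m.+1 - a ^+ m.+1] as [b - a] times [m.+1] monomials, each of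
    which lies between [a ^+ m] and [b ^+ m]. *)
Lemma expr_diff_bounds {R : realFieldType} (m : nat) (a b : R) : 0 <= a -> a <= b ->
  (b - a) * m.+1%:R * a ^+ m <= b ^+ m.+1 - a ^+ m.+1 <= (b - a) * m.+1%:R * b ^+ m.
Proof.
move=> a0 ab; rewrite subrXX -!mulrA; have ba : 0 <= b - a by rewrite subr_ge0.
have e (c : R) : m.+1%:R * c ^+ m = \sum_(i < m.+1) c ^+ m.
  by rewrite sumr_const card_ord mulr_natl.
have b0 := le_trans a0 ab.
have sp (c : R) (i : 'I_m.+1) : c ^+ m = c ^+ (m.+1.-1 - i) * c ^+ i.
  by rewrite -exprD subnK // -ltnS.
rewrite !e; apply/andP; split; apply: ler_wpM2l => //; apply: ler_sum => i _.
  rewrite [leLHS](sp a i); apply: ler_wpM2r; first exact: exprn_ge0.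
  exact: lerXn2r.
rewrite [leRHS](sp b i); apply: ler_wpM2l; first exact: exprn_ge0.
exact: lerXn2r.
Qed.

Definition pos_pow {R : realFieldType} (m : nat) (a : R) : R := Num.max 0 a ^+ m.

Lemma pos_pow_ge0 {R : realFieldType} (m : nat) (a : R) : 0 <= pos_pow m a.
Proof. by apply: exprn_ge0; rewrite le_max lexx. Qed.

Lemma pos_pow_eq0 {R : realFieldType} (m : nat) (a : R) : a <= 0 -> pos_pow m.+1 a = 0.
Proof. by move=> a0; rewrite /pos_pow max_l// expr0n. Qed.

Lemma pos_powS {R : realFieldType} (m : nat) (a : R) :
  a * pos_pow m.+1 a = pos_pow m.+2 a.
Proof.
have [a0|a0] := leP a 0; first by rewrite !pos_pow_eq0// mulr0.
by rewrite /pos_pow max_r 1?ltW// [RHS]exprS.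
Qed.

Lemma pos_pow_diff_ge {R : realFieldType} (m : nat) (a b : R) : a <= b ->
  (b - a) * m.+2%:R * pos_pow m.+1 a <= pos_pow m.+2 b - pos_pow m.+2 a.
Proof.
move=> ab; have [a0|/ltW a0] := leP a 0.
  by rewrite !(pos_pow_eq0 _ a)// mulr0 subr0 pos_pow_ge0.
have b0 := le_trans a0 ab.
by rewrite /pos_pow !max_r//; have /andP[] := expr_diff_bounds m.+1 a b a0 ab.
Qed.

Lemma pos_pow_diff_le {R : realFieldType} (m : nat) (a b : R) : a <= b ->
  pos_pow m.+1 b - pos_pow m.+1 a <= (b - a) * m.+1%:R * pos_pow m b.
Proof.
move=> ab; set x := Num.max 0 a; set y := Num.max 0 b.
have x0 : 0 <= x by rewrite le_max lexx.
have xy : x <= y by rewrite ge_max !le_max lexx ab orbT.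
have yx : y - x <= b - a.
  rewrite /x /y; case: (leP 0 a) => a0; case: (leP 0 b) => b0; lra.
have /andP[_] := expr_diff_bounds m x y x0 xy.
move=> h; apply: le_trans h _; rewrite -!mulrA; apply: ler_wpM2r => //.
by rewrite mulr_ge0 // exprn_ge0// (le_trans x0).
Qed.

(** The error is at most [h] times the variation of the derivative on the
    interval; the same estimate, one degree lower, bounds that variation.  The
    constant depends on [a] only through an upper bound [A], which makes the
    estimate uniform over all arguments [s - |x|^2] with [s] fixed. *)
Lemma pos_pow_taylor {R : realFieldType} (m : nat) (A a h : R) :
  a <= A -> 0 <= A -> `|h| <= 1 ->
  `|pos_pow m.+2 (a + h) - pos_pow m.+2 a - h * (m.+2%:R * pos_pow m.+1 a)|
  <= m.+2%:R * m.+1%:R * (A + 1) ^+ m * h ^+ 2.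
Proof.
move=> aA A0 h1.
have key (x y : R) : x <= y -> y <= A + 1 ->
   (y - x) * m.+2%:R * (pos_pow m.+1 y - pos_pow m.+1 x) <=
   m.+2%:R * m.+1%:R * (A + 1) ^+ m * (y - x) ^+ 2.
  move=> xy yA; have := pos_pow_diff_le m x y xy => H.
  have yx : 0 <= (y - x) * m.+2%:R by rewrite mulr_ge0// subr_ge0.
  apply: le_trans (ler_wpM2l yx H) _.
  rewrite [leLHS](_ : _ = m.+2%:R * m.+1%:R * (y - x) ^+ 2 * pos_pow m y); last by ring.
  rewrite [leRHS](_ : _ = m.+2%:R * m.+1%:R * (y - x) ^+ 2 * (A + 1) ^+ m); last by ring.
  apply: ler_wpM2l; first by rewrite !mulr_ge0 // subr_ge0.
  apply: lerXn2r; rewrite ?nnegrE ?le_max ?lexx//; first lra.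
  by rewrite ge_max yA; lra.
have [h0|h0] := leP 0 h.
  have ah : a <= a + h by lra.
  have H1 := pos_pow_diff_ge m _ _ ah.
  have H2 := pos_pow_diff_le m.+1 _ _ ah.
  have hh : a + h - a = h by ring.
  have H3 := key _ _ ah; rewrite hh in H1 H2 H3.
  rewrite ger0_norm; last by rewrite mulrA subr_ge0.
  apply: le_trans (H3 _); first by rewrite mulrBr [leLHS]addrC mulrA; lra.
  by move: h1; rewrite ger0_norm//; lra.
have ah : a + h <= a by lra.
have H1 := pos_pow_diff_ge m _ _ ah.
have H2 := pos_pow_diff_le m.+1 _ _ ah.
have hh : a - (a + h) = - h by ring.
have H3 := key _ _ ah; rewrite hh in H1 H2 H3.
rewrite ger0_norm; last by move: H2; rewrite !mulNr -mulrA; lra.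
rewrite -(sqrrN h); apply: le_trans (H3 _); first by rewrite mulrBr !mulNr -!mulrA in H1 H2 *; lra.
by move: h1; rewrite ltr0_norm//; lra.
Qed.

Lemma is_derive_pos_pow {R : realType} (m : nat) (a : R) :
  is_derive a 1 (pos_pow m.+2) (m.+2%:R * pos_pow m.+1 a).
Proof.
apply: (is_derive_quadratic (m.+2%:R * m.+1%:R * (`|a| + 1) ^+ m)) => h h1.
by rewrite [h *: _]mulr1; apply: pos_pow_taylor; rewrite ?ler_norm.
Qed.

Lemma continuous_pos_pow {R : realType} (m : nat) : continuous (pos_pow m : R -> R).
Proof.
move=> a; rewrite /pos_pow.
apply: (@continuous_comp _ _ _ (Num.max (0:R)) (fun x => x ^+ m)); last exact: exprn_continuous.
exact: continuous_max (cvg_cst _) (cvg_id).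
Qed.

(** * Riemann sums over cubes *)

Definition cube {R : realType} {N : nat} (q : nat) : set 'rV[R]_N :=
  [set x | forall i, `|x 0 i| <= q%:R].

(** The mesh is [1 / n.+1] and the grid contains the lower faces of the cube but
    not the upper ones: it is a torus in disguise, on which one step in a
    coordinate direction is a permutation. *)
Definition grid_pt {R : realType} {N : nat} (q n : nat)
    (k : {ffun 'I_N -> 'I_(2 * q * n.+1)}) : 'rV[R]_N :=
  \row_i ((k i)%:R / n.+1%:R - q%:R).

Definition riemann_sum {R : realType} {N : nat} (q : nat) (f : 'rV[R]_N -> R) (n : nat) : R :=
  n.+1%:R^-1 ^+ N * \sum_k f (grid_pt q n k).

Lemma grid_pt_cube {R : realType} {N : nat} (q n : nat)
    (k : {ffun 'I_N -> 'I_(2 * q * n.+1)}) : cube q (grid_pt q n k : 'rV[R]_N).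
Proof.
move=> i; rewrite mxE ler_norml lerBrDr addrC subrr divr_ge0//= lerBlDr.
by rewrite ler_pdivrMr// -natrD -natrM ler_nat addnn -mul2n ltnW.
Qed.

Lemma riemann_sum_bound {R : realType} {N : nat} (q : nat) (f : 'rV[R]_N -> R) (C : R) n :
  (forall x, cube q x -> `|f x| <= C) ->
  `|riemann_sum q f n| <= (2 * q)%:R ^+ N * C.
Proof.
move=> fC; rewrite /riemann_sum normrM ger0_norm ?exprn_ge0//.
have -> : (2 * q)%:R ^+ N = n.+1%:R^-1 ^+ N * ((2 * q * n.+1) ^ N)%:R :> R.
  by rewrite natrX (natrM _ (2 * q)) exprMn mulrCA -exprMn mulVf ?expr1n ?mulr1.
rewrite -mulrA; apply: ler_wpM2l; first exact: exprn_ge0.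
apply: le_trans (ler_norm_sum _ _ _) _.
apply: le_trans (ler_sum _ (fun k _ => fC _ (grid_pt_cube q n k))) _.
by rewrite sumr_const card_ffun !card_ord mulr_natl.
Qed.

(** The unit cube contains exactly [n.+1 ^ N] grid points, namely those whose
    indices lie in the range of [phi]. *)
Lemma riemann_sum_ge1 {R : realType} {N : nat} (q : nat) (f : 'rV[R]_N -> R) n :
  (0 < q)%N ->
  (forall x, cube q x -> 0 <= f x) ->
  (forall x : 'rV[R]_N, (forall i, 0 <= x 0 i <= 1) -> 1 <= f x) ->
  1 <= riemann_sum q f n.
Proof.
move=> q0 f0 f1.
have lt j : (j < n.+1 -> q * n.+1 + j < 2 * q * n.+1)%N.
  move=> jn; rewrite mul2n -addnn mulnDl ltn_add2l (leq_trans jn)//.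
  by rewrite leq_pmull.
pose phi (j : 'I_n.+1) := Ordinal (lt j (ltn_ord j)).
have phi_inj : injective phi by move=> i j /(congr1 val)/= /addnI/val_inj.
rewrite /riemann_sum exprVn ler_pdivlMl ?exprn_gt0// mulr1.
rewrite (bigID (fun k : {ffun 'I_N -> 'I_(2 * q * n.+1)} => k \in ffun_on (codom phi))) /=.
rewrite ler_wpDr//; first by apply: sumr_ge0 => k _; apply: f0; exact: grid_pt_cube.
have -> : n.+1%:R ^+ N = \sum_(k : {ffun 'I_N -> 'I_(2 * q * n.+1)} | k \in ffun_on (codom phi)) (1 : R).
  by rewrite sumr_const card_ffun_on card_codom// !card_ord natrX.
apply: ler_sum => k /ffun_onP kP; apply: f1 => i; rewrite mxE.
have /codomP[j ->] := kP i; rewrite /= natrD natrM mulrDl mulfK// addrC addKr.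
by rewrite divr_ge0//= ler_pdivrMr// mul1r ler_nat ltnW.
Qed.

(** Discrete integration by parts: the cyclic shift of the [i]-th index permutes
    the grid and agrees with the translation by one mesh except where it wraps
    around; there one point lies on the upper face, the other on the lower face,
    and [f] vanishes at both. *)
Lemma riemann_sum_shift {R : realType} {N : nat} (q : nat) (f : 'rV[R]_N -> R) n (i : 'I_N) :
  (forall x : 'rV[R]_N, `|x 0 i| = q%:R -> f x = 0) ->
  riemann_sum q (fun x => f (x + n.+1%:R^-1 *: 'e_i) - f x) n = 0.
Proof.
move=> f0; rewrite /riemann_sum; apply/eqP; rewrite mulf_eq0; apply/orP; right.
rewrite sumrB subr_eq0; apply/eqP.
pose sh (g : 'I_(2 * q * n.+1) -> 'I_(2 * q * n.+1))
    (k : {ffun 'I_N -> 'I_(2 * q * n.+1)}) : {ffun 'I_N -> 'I_(2 * q * n.+1)} :=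
  [ffun j => if j == i then g (k j) else k j].
have shK : cancel (sh (@ordS _)) (sh (@ord_pred _)).
  by move=> k; apply/ffunP => j; rewrite !ffunE; case: (j == i); rewrite ?ordSK.
have sh_inj := can_inj shK.
rewrite [RHS](reindex_inj sh_inj); apply: eq_bigr => k _.
have [kM|kM] := boolP ((k i).+1 < 2 * q * n.+1)%N.
  congr f; apply/rowP => j; rewrite !mxE ffunE eqxx /= (eq_sym j i).
  case: eqP => [<-|_]; last by rewrite mulr0 addr0.
  by rewrite /= modn_small// mulr1 addrAC -[X in _ = X / _ - _]natr1 mulrDl mul1r.
have kE : (k i).+1 = (2 * q * n.+1)%N.
  by apply/eqP; rewrite eqn_leq ltn_ord /= leqNgt.
(* wrap-around: [k i] is the last index *)
rewrite [LHS]f0 ?[RHS]f0//.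
  rewrite !mxE ffunE eqxx /= kE modnn mul0r sub0r normrN ger0_norm//.
rewrite !mxE !eqxx mulr1 addrAC -[X in _ + X - _]mul1r -mulrDl natr1 kE.
by rewrite natrM mulfK// natrM [2 * _]mulr_natl mulr2n addrK ger0_norm.
Qed.

(** * A positive linear functional that annihilates derivatives *)

(** A limit along an ultrafilter exists for every bounded sequence and is still
    linear and monotone, so no convergence of Riemann sums has to be proved. *)
Definition ultra_nat : set_system nat :=
  projT1 (cid (ultraFilterLemma eventually_filter)).

#[local] Instance ultra_nat_ultra : UltraFilter ultra_nat.
Proof. by rewrite /ultra_nat; case: cid => /= ? []. Qed.

#[local] Instance ultra_nat_proper : ProperFilter ultra_nat.
Proof. exact: ultra_proper. Qed.

Lemma ultra_nat_eventually : \oo `<=` ultra_nat.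
Proof. by rewrite /ultra_nat; case: cid => /= ? []. Qed.

(** By compactness the sequence has a cluster point [p] along the ultrafilter.
    For a neighbourhood [A] of [p] either [A] or its complement has a preimage
    in the ultrafilter, and the latter would contradict clustering. *)
Lemma bounded_cvg_ultra {R : realType} (a : nat -> R) (C : R) :
  (forall n, `|a n| <= C) -> cvg (a n @[n --> ultra_nat]).
Proof.
move=> aC.
have [|p [_ pa]] := @segment_compact R (- C) C (a n @[n --> ultra_nat]) _.
  by apply: (@filterE nat ultra_nat) => n /=; rewrite in_itv /= -ler_norml; exact: aC.
apply/cvg_ex; exists p => /= A pA.
have [//|AC] := @in_ultra_setVsetC _ ultra_nat (a @^-1` A) _.
by have [x [/= nA /nA]] := pa (~` A) A AC pA.
Qed.

(** The Riemann integral over the cube, on continuous functions; elsewhere the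
    limit may fail to exist and the value is arbitrary, hence the continuity
    hypotheses below. *)
Definition cube_integral {R : realType} {N : nat} (q : nat) (f : 'rV[R]_N -> R) : R :=
  lim (riemann_sum q f n @[n --> ultra_nat]).

Lemma cube_compact {R : realType} {N : nat} (q : nat) : compact (cube q : set 'rV[R]_N).
Proof.
have := @rV_compact R N (fun=> `[- q%:R, q%:R]%classic) (fun=> @segment_compact R _ _).
congr compact; apply/seteqP; split=> x /= H i; have := H i; rewrite /= in_itv /= ler_norml//.
Qed.

Lemma continuous_cube_bounded {R : realType} {N : nat} (q : nat) (f : 'rV[R]_N -> R) :
  continuous f -> exists2 C, 0 <= C & forall x, cube q x -> `|f x| <= C.
Proof.
move=> cf; have /compact_bounded[M [_ MP]] : compact (f @` cube q).
  by apply: continuous_compact; [exact: continuous_subspaceT|exact: cube_compact].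
exists (`|M| + 1) => [|x xq]; first by rewrite addr_ge0.
by apply: (MP (`|M| + 1)); [rewrite (le_lt_trans (ler_norm _))// ltrDl|exists x].
Qed.

Lemma riemann_sum_cvg {R : realType} {N : nat} (q : nat) (f : 'rV[R]_N -> R) :
  continuous f -> riemann_sum q f n @[n --> ultra_nat] --> cube_integral q f.
Proof.
move=> /(continuous_cube_bounded q)[C C0 fC]; rewrite /cube_integral.
apply: (bounded_cvg_ultra _ ((2 * q)%:R ^+ N * C)) => n.
exact: riemann_sum_bound.
Qed.

Lemma cube_integral_lin {R : realType} {N : nat} (q : nat) (a : R) (f g : 'rV[R]_N -> R) :
  continuous f -> continuous g ->
  cube_integral q (fun x => a * f x + g x) = a * cube_integral q f + cube_integral q g.
Proof.
move=> cf cg; apply: cvg_lim => //.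
rewrite (_ : riemann_sum _ _ = fun n => a * riemann_sum q f n + riemann_sum q g n); last first.
  apply/funext => n; rewrite /riemann_sum big_split /= mulrDr -mulr_sumr; congr (_ + _).
  by rewrite mulrCA.
by apply: cvgD; [apply: cvgMr|]; exact: riemann_sum_cvg.
Qed.

Lemma le_cube_integral {R : realType} {N : nat} (q : nat) (f g : 'rV[R]_N -> R) :
  continuous f -> continuous g -> (forall x, cube q x -> f x <= g x) ->
  cube_integral q f <= cube_integral q g.
Proof.
move=> cf cg fg.
apply: (ler_lim (cvgP _ (riemann_sum_cvg _ _ cf)) (cvgP _ (riemann_sum_cvg _ _ cg))).
apply: nearW => n; apply: ler_wpM2l; first exact: exprn_ge0.
by apply: ler_sum => k _; apply: fg; exact: grid_pt_cube.
Qed.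

(** Guarantees that the functional is not zero. *)
Lemma cube_integral_ge1 {R : realType} {N : nat} (q : nat) (f : 'rV[R]_N -> R) :
  (0 < q)%N -> continuous f ->
  (forall x, cube q x -> 0 <= f x) ->
  (forall x : 'rV[R]_N, (forall i, 0 <= x 0 i <= 1) -> 1 <= f x) ->
  1 <= cube_integral q f.
Proof.
move=> q0 cf f0 f1.
apply: (limr_ge (cvgP _ (riemann_sum_cvg _ _ cf))).
by apply: nearW => n; apply: riemann_sum_ge1.
Qed.

Lemma cube_unif_continuous {R : realType} {N : nat} (q : nat)
    (g : 'rV[R]_N -> R) (v : 'rV[R]_N) :
  continuous g -> forall e, 0 < e ->
  exists2 d, 0 < d &
    forall x h, cube q x -> `|h| <= d -> `|g (x + h *: v) - g x| <= e.
Proof.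
move=> cg e e0; have /compact_near_coveringP cK := @cube_compact R N q.
have := cK R (nbhs (0 : R)) (fun h x => `|g (x + h *: v) - g x| <= e) _.
case=> [x _|d /= d0 dP].
  have cz : (g (z.1 + z.2 *: v) - g z.1) @[z --> (x, 0 : R)] --> (0 : R).
    rewrite -[X in _ --> X](subrr (g x)); apply: cvgB; last first.
      by apply: continuous_cvg; [exact: cg|exact: cvg_fst].
    rewrite -[X in g X](addr0 x) -(scale0r v).
    apply: (continuous_cvg _ (cg _)); apply: cvgD; first exact: cvg_fst.
    by apply: cvgZ; [exact: cvg_snd|exact: cvg_cst].
  by move/cvgr_distC_le : cz => /(_ e e0); apply: filterS => -[y h] /=; rewrite subr0.
exists (d / 2); first by rewrite divr_gt0.
move=> x h xK hd; apply: dP => //=; rewrite sub0r normrN.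
by rewrite (le_lt_trans hd)// ltr_pdivrMr// ltr_pMr// ltr1n.
Qed.

(** By the mean value theorem the quotient is a value of [G] at distance at most
    [h], so uniform continuity of [G] applies. *)
Lemma cube_unif_derive {R : realType} {N : nat} (q : nat)
    (F G : 'rV[R]_N -> R) (v : 'rV[R]_N) :
  (forall x, is_derive x v F (G x)) -> continuous G -> forall e, 0 < e ->
  exists2 d, 0 < d &
    forall x h, cube q x -> 0 < h -> h <= d ->
      `|h^-1 * (F (x + h *: v) - F x) - G x| <= e.
Proof.
move=> dF cG e e0; have [d d0 dP] := cube_unif_continuous q G v cG e e0.
exists d => // x h xK h0 hd.
have dl (t : R) : is_derive t 1 (fun t : R => F (x + t *: v)) (G (x + t *: v)).
  exact: (proj1 (is_derive_line F x v t (G (x + t *: v))) (dF _)).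
have [|c] := MVT_segment (ltW h0) (fun t _ => dl t).
  apply: derivable_within_continuous => t _; exact: ex_derive.
rewrite in_itv /= scale0r addr0 subr0 => /andP[c0 ch] ->.
by rewrite mulrC mulfK ?gt_eqF// dP// ger0_norm// (le_trans ch).
Qed.

(** The divergence theorem in the only form needed.  Up to a uniformly small
    error [G] is the difference quotient of [F] with step the mesh, whose Riemann
    sum vanishes by [riemann_sum_shift]. *)
Lemma cube_integral_derive0 {R : realType} {N : nat} (q : nat) (F G : 'rV[R]_N -> R) (i : 'I_N) :
  (forall x, is_derive x 'e_i F (G x)) -> continuous G ->
  (forall x : 'rV[R]_N, `|x 0 i| = q%:R -> F x = 0) ->
  cube_integral q G = 0.
Proof.
move=> dF cG F0.
suff cv : riemann_sum q G n @[n --> \oo] --> (0 : R).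
  by apply: cvg_lim => //; apply: cvg_trans cv; apply: cvg_app; exact: ultra_nat_eventually.
apply/cvgr0Pnorm_le => e e0.
pose K : R := (2 * q)%:R ^+ N.
have K0 : 0 <= K by rewrite exprn_ge0.
have e'0 : 0 < e / (K + 1) by rewrite divr_gt0// ltr_wpDl.
have [d d0 dP] := cube_unif_derive q F G 'e_i dF cG _ e'0.
near=> n.
have nd : n.+1%:R^-1 <= d.
  by apply/ltW; near: n; exact: near_infty_natSinv_lt (PosNum d0).
pose S x := F (x + n.+1%:R^-1 *: 'e_i) - F x.
have -> : riemann_sum q G n =
    - riemann_sum q (fun x => n.+1%:R^-1^-1 * S x - G x) n.
  have := riemann_sum_shift q F n i F0; rewrite -/S /riemann_sum => /eqP.
  rewrite mulf_eq0 expf_eq0 invr_eq0 pnatr_eq0 andbF /= => /eqP S0.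
  by rewrite sumrB -mulr_sumr S0 mulr0 sub0r mulrN opprK.
rewrite normrN; apply: le_trans (riemann_sum_bound q _ (e / (K + 1)) n _) _.
  by move=> x xK; apply: dP.
by rewrite -/K mulrCA ger_pMr// ler_pdivrMr ?mul1r ?lerDl// ltr_wpDl.
Unshelve. all: by end_near. Qed.

(** * Functions of class C^k *)

Lemma continuous_add {R : realType} {N : nat} {f g : 'rV[R]_N -> R} :
  continuous f -> continuous g -> continuous (fun x => f x + g x).
Proof. by move=> cf cg x; exact: cvgD (cf x) (cg x). Qed.

Lemma continuous_mul {R : realType} {N : nat} {f g : 'rV[R]_N -> R} :
  continuous f -> continuous g -> continuous (fun x => f x * g x).
Proof. by move=> cf cg x; exact: cvgM (cf x) (cg x). Qed.

Lemma continuous_cst {R : realType} {N : nat} (c : R) :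
  continuous (fun _ : 'rV[R]_N => c).
Proof. exact: cst_continuous. Qed.

Lemma classC_continuous {R : realType} {N k : nat} {u : 'rV[R]_N -> R} :
  classC k u -> continuous u.
Proof. by case: k => [|k] // []. Qed.

Lemma classC_weaken {R : realType} {N : nat} (k : nat) (u : 'rV[R]_N -> R) :
  classC k.+1 u -> classC k u.
Proof.
elim: k u => [|k IH] u [cu du] //; split=> // i; have [di ci] := du i.
by split=> //; exact: IH.
Qed.

Lemma classC_add {R : realType} {N : nat} (k : nat) (u v : 'rV[R]_N -> R) :
  classC k u -> classC k v -> classC k (fun x => u x + v x).
Proof.
elim: k u v => [|k IH] u v; first exact: continuous_add.
move=> [cu du] [cv dv]; split; first exact: continuous_add.
move=> i; have [u1 u2] := du i; have [v1 v2] := dv i; split.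
  by move=> x; apply: derivableD.
have -> : partial i (fun x => u x + v x) = fun x => partial i u x + partial i v x.
  by apply/funext => x; rewrite /partial; apply: deriveD.
exact: IH.
Qed.

Lemma classC_cst {R : realType} {N : nat} (k : nat) (c : R) :
  classC k (fun _ : 'rV[R]_N => c).
Proof.
elim: k c => [|k IH] c; first exact: continuous_cst.
split; first exact: continuous_cst.
move=> i; split; first by move=> x; exact: derivable_cst.
have -> : partial i (fun _ : 'rV[R]_N => c) = fun=> 0.
  by apply/funext => x; rewrite /partial; exact: derive_cst.
exact: IH.
Qed.

Lemma classC_laplacian {R : realType} {N : nat} (k : nat) (u : 'rV[R]_N -> R) :
  classC k.+2 u -> classC k (laplacian u).
Proof.
move=> [_ du]; rewrite /laplacian.
elim: (index_enum _) => [|i r IH].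
  have -> : (fun x : 'rV[R]_N => \sum_(i <- [::]) partial i (partial i u) x) = fun=> 0.
    by apply/funext => x; rewrite big_nil.
  exact: classC_cst.
have -> : (fun x : 'rV[R]_N => \sum_(i <- i :: r) partial i (partial i u) x) =
  fun x => partial i (partial i u) x + \sum_(i <- r) partial i (partial i u) x.
  by apply/funext => x; rewrite big_cons.
apply: classC_add => //.
by have [_ [_ /(_ i)[]]] := du i.
Qed.

(** * Linearity and monotonicity of the functional *)

Lemma continuous_sum {R : realType} {N : nat} (I : Type) (r : seq I)
    (f : I -> 'rV[R]_N -> R) :
  (forall i, continuous (f i)) -> continuous (fun x => \sum_(i <- r) f i x).
Proof. by move=> cf; apply: continuous_big => //; exact: add_continuous. Qed.

Lemma cube_integral0 {R : realType} {N : nat} (q : nat) :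
  cube_integral q (fun _ : 'rV[R]_N => 0) = 0.
Proof.
have c0 := @continuous_cst R N 0; have := cube_integral_lin q 1 _ _ c0 c0.
rewrite (_ : (fun x : 'rV[R]_N => 1 * 0 + 0) = fun=> 0); last first.
  by apply/funext => x; rewrite mulr0 addr0.
by move=> /eqP; rewrite mul1r addrC -subr_eq subrr eq_sym => /eqP.
Qed.

Lemma cube_integral_scale {R : realType} {N : nat} (q : nat) (a : R) (f : 'rV[R]_N -> R) :
  continuous f -> cube_integral q (fun x => a * f x) = a * cube_integral q f.
Proof.
move=> cf; have := cube_integral_lin q a f _ cf (continuous_cst 0).
rewrite cube_integral0 addr0 => <-; congr cube_integral; apply/funext => x; by rewrite addr0.
Qed.

Lemma cube_integral_sum {R : realType} {N : nat} (q n : nat) (f : 'I_n -> 'rV[R]_N -> R) :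
  (forall i, continuous (f i)) ->
  cube_integral q (fun x => \sum_(i < n) f i x) = \sum_(i < n) cube_integral q (f i).
Proof.
move=> cf.
elim: (index_enum _) => [|i r IH].
  rewrite big_nil -[RHS](@cube_integral0 R N q); congr cube_integral.
  by apply/funext => x; rewrite big_nil.
have -> : (fun x : 'rV[R]_N => \sum_(i <- i :: r) f i x) =
  fun x => 1 * f i x + \sum_(i <- r) f i x.
  by apply/funext => x; rewrite big_cons mul1r.
by rewrite cube_integral_lin ?IH ?big_cons ?mul1r//; exact: continuous_sum.
Qed.

Lemma le_norm_cube_integral {R : realType} {N : nat} (q : nat) (f g : 'rV[R]_N -> R) :
  continuous f -> continuous g -> (forall x, cube q x -> `|f x| <= g x) ->
  `|cube_integral q f| <= cube_integral q g.
Proof.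
move=> cf cg fg; rewrite ler_norml; apply/andP; split.
  rewrite -mulN1r -cube_integral_scale//; apply: le_cube_integral => //.
    by apply: continuous_mul => //; exact: continuous_cst.
  by move=> x /fg; rewrite ler_norml mulN1r => /andP[].
by apply: le_cube_integral => // x /fg; rewrite ler_norml => /andP[].
Qed.

(** * The bumps (s - |x|^2)_+^m and their integrals *)

Definition sqnorm {R : realType} {N : nat} (x : 'rV[R]_N) : R := \sum_i x 0 i ^+ 2.

Lemma is_derive_sqnorm {R : realType} {N : nat} (x : 'rV[R]_N) (i : 'I_N) :
  is_derive x 'e_i (sqnorm) (2 * x 0 i).
Proof.
apply: (is_derive_quadratic 1) => h _.
rewrite (_ : _ - _ = h ^+ 2) ?mul1r ?ger0_norm ?sqr_ge0//.
rewrite /sqnorm (bigD1 i)//= [X in _ - X - _](bigD1 i)//= !mxE !eqxx.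
under eq_bigr => j ji do rewrite !mxE eqxx /= (negbTE ji) mulr0 addr0.
by rewrite /=; ring.
Qed.

Lemma continuous_sqr_coord {R : realType} {N : nat} (i : 'I_N) :
  continuous (fun x : 'rV[R]_N => x 0 i ^+ 2).
Proof.
move=> x.
apply: (@continuous_comp _ _ _ (fun y : 'rV[R]_N => y 0 i) (fun t => t ^+ 2)).
  exact: coord_continuous.
exact: exprn_continuous.
Qed.

Lemma continuous_sqnorm {R : realType} {N : nat} : continuous (@sqnorm R N).
Proof.
by apply: continuous_sum => i; exact: continuous_sqr_coord.
Qed.

Lemma is_derive_congr {R : realType} {V : normedModType R} {f g : V -> R}
    {x v : V} {d d' : R} :
  is_derive x v f d -> f = g -> d = d' -> is_derive x v g d'.
Proof. by move=> ? <- <-. Qed.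

Definition bump {R : realType} {N : nat} (m : nat) (s : R) (x : 'rV[R]_N) : R :=
  pos_pow m (s - sqnorm x).

Lemma continuous_bump {R : realType} {N : nat} (m : nat) (s : R) : continuous (bump m s : 'rV[R]_N -> R).
Proof.
move=> x; apply: (@continuous_comp _ _ _ (fun x => s - sqnorm x) (pos_pow m)).
  exact: cvgB (continuous_cst s x) (continuous_sqnorm x).
exact: continuous_pos_pow.
Qed.

Lemma is_derive_comp_real {R : realType} {V : normedModType R} {f : V -> R} {g : R -> R}
    {x v : V} {d d' : R} :
  is_derive x v f d -> is_derive (f x) 1 g d' -> is_derive x v (g \o f) (d' * d).
Proof.
move=> df dg; rewrite -[x in is_derive x](addr0 x) -(scale0r v).
apply: (proj2 (is_derive_line (g \o f) x v 0 (d' * d))).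
apply: (@is_derive1_comp R g (fun h => f (x + h *: v)) 0).
  by rewrite scale0r addr0.
apply: (proj1 (is_derive_line f x v 0 d)).
by rewrite scale0r addr0.
Qed.

Lemma is_derive_bump {R : realType} {N : nat} (m : nat) (s : R) (x : 'rV[R]_N) (i : 'I_N) :
  is_derive x 'e_i (bump m.+2 s) (- (2 * m.+2%:R * x 0 i * bump m.+1 s x)).
Proof.
have ds : is_derive x 'e_i (cst s - sqnorm) (0 - 2 * x 0 i).
  by apply: is_deriveB; exact: is_derive_sqnorm.
have dp := is_derive_pos_pow m (s - sqnorm x).
have := is_derive_comp_real ds dp.
rewrite (_ : _ * (0 - _) = - (2 * m.+2%:R * x 0 i * bump m.+1 s x)) //.
by rewrite /bump; ring.
Qed.

Lemma is_derive_coord {R : realType} {N : nat} (x : 'rV[R]_N) (i : 'I_N) :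
  is_derive x 'e_i (fun y : 'rV[R]_N => y 0 i) 1.
Proof.
apply: (is_derive_quadratic 0) => h _.
by rewrite !mxE !eqxx !mulr1 [_ + h]addrC addrK subrr normr0 mul0r.
Qed.

Lemma is_derive2_bump {R : realType} {N : nat} (m : nat) (s : R) (x : 'rV[R]_N) (i : 'I_N) :
  is_derive x 'e_i (fun y : 'rV[R]_N => - (2 * m.+3%:R * y 0 i * bump m.+2 s y))
   (4 * m.+3%:R * m.+2%:R * x 0 i ^+ 2 * bump m.+1 s x - 2 * m.+3%:R * bump m.+2 s x).
Proof.
have dc := is_derive_coord x i.
have dp := is_derive_bump m s x i.
have dM := is_deriveM dc dp.
have dZ := is_deriveZ (- (2 * m.+3%:R)) dM.
apply: (is_derive_congr dZ).
  apply/funext => y.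
  by rewrite -[LHS]/(- (2 * m.+3%:R) * (y 0 i * bump m.+2 s y)) mulNr -mulrA.
by rewrite /GRing.scale /=; ring.
Qed.

(** The ball of radius [sqrt s] fits in the cube, so functions carrying a bump as
    a factor have no boundary terms. *)
Lemma bump_face0 {R : realType} {N : nat} (q m : nat) (s : R) (x : 'rV[R]_N) (i : 'I_N) :
  s <= q%:R ^+ 2 -> `|x 0 i| = q%:R -> bump m.+1 s x = 0.
Proof.
move=> sq xq; apply: pos_pow_eq0; rewrite subr_le0 (le_trans sq)// -xq.
rewrite real_normK ?num_real// /sqnorm (bigD1 i)//= lerDl sumr_ge0// => j _.
exact: sqr_ge0.
Qed.

Definition bump_integral {R : realType} {N : nat} (q m : nat) (s : R)
    (f : 'rV[R]_N -> R) : R :=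
  cube_integral q (fun x => bump m s x * f x).

(** Green's formula moves the Laplacian from [f] to the bump.  In
    [laplacian (bump m.+3 s)] the factor [|x|^2] is eliminated by
    [|x|^2 bump m.+1 s = s bump m.+1 s - bump m.+2 s], so only integrals of [f]
    against bumps remain. *)
Lemma green_bump {R : realType} {N : nat} (q m : nat) (s : R) (f : 'rV[R]_N -> R) :
  classC 2 f -> s <= q%:R ^+ 2 ->
  bump_integral q m.+3 s (laplacian f) =
   4 * m.+3%:R * m.+2%:R * s * bump_integral q m.+1 s f
   - 2 * m.+3%:R * (2 * m.+2%:R + N%:R) * bump_integral q m.+2 s f.
Proof.
move=> C2 sq; have cf := classC_continuous C2.
have cb k := @continuous_bump R N k s.
(* the second partial derivatives of [bump m.+3 s] *)
pose b2 (i : 'I_N) (x : 'rV[R]_N) :=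
  4 * m.+3%:R * m.+2%:R * x 0 i ^+ 2 * bump m.+1 s x - 2 * m.+3%:R * bump m.+2 s x.
have cc (c : R) := @continuous_cst R N c.
have cb2 i : continuous (b2 i).
  have cX := @continuous_sqr_coord R N i.
  have -> : b2 i = fun x => 4 * m.+3%:R * m.+2%:R * (x 0 i ^+ 2 * bump m.+1 s x)
      + (- (2 * m.+3%:R)) * bump m.+2 s x.
    by apply/funext => x; rewrite mulNr mulrA.
  exact: continuous_add (continuous_mul (cc _) (continuous_mul cX (cb _)))
    (continuous_mul (cc _) (cb _)).
have cd i : continuous (partial i (partial i f)).
  by have [_ /(_ i)[_ [_ /(_ i)[_ c]]]] := C2; exact: c.
(* integrate [d_i (bump * d_i f - f * d_i bump)], in which the products of
   first derivatives cancel *)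
have z i : cube_integral q (fun x => bump m.+3 s x * partial i (partial i f) x
      + (-1) * (f x * b2 i x)) = 0.
  have [_ /(_ i)[d1 [_ /(_ i)[d2 _]]]] := C2.
  apply: (cube_integral_derive0 q (fun x => bump m.+3 s x * partial i f x
      - f x * (- (2 * m.+3%:R * x 0 i * bump m.+2 s x))) _ i).
  - move=> x.
    have db := is_derive_bump m.+1 s x i.
    have db2 := is_derive2_bump m s x i.
    have df : is_derive x 'e_i f (partial i f x) := derivableP (d1 x).
    have ddf : is_derive x 'e_i (partial i f) (partial i (partial i f) x) :=
      derivableP (d2 x).
    have D := is_deriveB (is_deriveM db ddf) (is_deriveM df db2).
    apply: (is_derive_congr D) => //.
    by rewrite /GRing.scale /= /b2; ring.
  - exact: continuous_add (continuous_mul (cb _) (cd i))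
      (continuous_mul (cc _) (continuous_mul cf (cb2 i))).
  - move=> x xq; rewrite !(bump_face0 q _ s x i)//; ring.
have e1 : bump_integral q m.+3 s (laplacian f) =
    \sum_i cube_integral q (fun x => bump m.+3 s x * partial i (partial i f) x).
  rewrite -cube_integral_sum; last by move=> i; exact: continuous_mul.
  by congr cube_integral; apply/funext => x; rewrite /laplacian mulr_sumr.
have e2 : \sum_i cube_integral q (fun x => f x * b2 i x) = bump_integral q m.+3 s (laplacian f).
  rewrite e1; apply: eq_bigr => i _; move: (z i).
  have -> : (fun x => bump m.+3 s x * partial i (partial i f) x + -1 * (f x * b2 i x)) =
     fun x => (-1) * (f x * b2 i x) + bump m.+3 s x * partial i (partial i f) x.
    by apply/funext => x; rewrite addrC.
  rewrite cube_integral_lin; [|exact: continuous_mul|exact: continuous_mul].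
  by rewrite mulN1r addrC => /eqP; rewrite subr_eq0 => /eqP.
rewrite -e2 -cube_integral_sum; last by move=> i; exact: continuous_mul.
rewrite -mulNr -[X in _ = _ + X]cube_integral_scale; last exact: continuous_mul.
rewrite -[RHS]cube_integral_lin; [|exact: continuous_mul|].
  2: exact: continuous_mul (cc _) (continuous_mul (cb _) cf).
congr cube_integral; apply/funext => x; rewrite -mulr_sumr /b2 sumrB sumr_const card_ord.
rewrite -mulr_suml -mulr_sumr -/(sqnorm x).
have H : s * bump m.+1 s x = sqnorm x * bump m.+1 s x + bump m.+2 s x.
  by rewrite /bump -pos_powS; ring.
rewrite -[_ *+ N]mulr_natr.
have -> : 4 * m.+3%:R * m.+2%:R * s * (bump m.+1 s x * f x) =
  4 * m.+3%:R * m.+2%:R * (s * bump m.+1 s x) * f x by ring.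
by rewrite H; ring.
Qed.

Lemma is_derive_bump_integral {R : realType} {N : nat} (q m : nat) (s : R)
    (f : 'rV[R]_N -> R) :
  continuous f ->
  is_derive s 1 (fun s => bump_integral q m.+2 s f) (m.+2%:R * bump_integral q m.+1 s f).
Proof.
move=> cf; have cb k t := @continuous_bump R N k t.
have cc (c : R) := @continuous_cst R N c.
have cn : continuous (fun x => `|f x|).
  by move=> x; apply: continuous_comp; [exact: cf|exact: norm_continuous].
pose K : R := m.+2%:R * m.+1%:R * (`|s| + 1) ^+ m.
apply: (is_derive_quadratic (K * cube_integral q (fun x => `|f x|))) => h h1.
rewrite [h *: _]mulr1.
rewrite [leRHS](_ : _ = K * h ^+ 2 * cube_integral q (fun x => `|f x|)); last by ring.
have c1 : continuous (fun x => h * (m.+2%:R * (bump m.+1 s x * f x))).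
  exact: (continuous_mul (cc _) (continuous_mul (cc _) (continuous_mul (cb _ _) cf))).
have c2 t : continuous (fun x => bump m.+2 t x * f x) by exact: continuous_mul.
have c3 : continuous (fun x => -1 * (bump m.+2 s x * f x) + bump m.+2 (s + h) x * f x).
  exact: continuous_add (continuous_mul (cc _) (c2 _)) (c2 _).
have -> : bump_integral q m.+2 (s + h) f - bump_integral q m.+2 s f
    - h * (m.+2%:R * bump_integral q m.+1 s f) =
  cube_integral q (fun x => (-1) * (h * (m.+2%:R * (bump m.+1 s x * f x))) +
     ((-1) * (bump m.+2 s x * f x) + bump m.+2 (s + h) x * f x)).
  rewrite cube_integral_lin// cube_integral_lin// cube_integral_scale; last first.
    by apply: continuous_mul => //; exact: continuous_mul.
  rewrite cube_integral_scale; last exact: continuous_mul.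
  by rewrite /bump_integral; ring.
rewrite -cube_integral_scale//; apply: le_norm_cube_integral.
- exact: continuous_add (continuous_mul (cc _) c1) c3.
- exact: continuous_mul.
move=> x _.
have -> : (-1) * (h * (m.+2%:R * (bump m.+1 s x * f x))) +
     ((-1) * (bump m.+2 s x * f x) + bump m.+2 (s + h) x * f x) =
  (bump m.+2 (s + h) x - bump m.+2 s x - h * (m.+2%:R * bump m.+1 s x)) * f x by ring.
rewrite normrM; apply: ler_wpM2r => //.
rewrite /bump (addrAC s h); apply: pos_pow_taylor => //.
rewrite (le_trans _ (ler_norm s))// gerBl sumr_ge0// => i _; exact: sqr_ge0.
Qed.

Lemma le_bump_integral {R : realType} {N : nat} (q m : nat) (s : R)
    (f g : 'rV[R]_N -> R) :
  continuous f -> continuous g ->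
  (forall x, sqnorm x <= s -> f x <= g x) ->
  bump_integral q m.+1 s f <= bump_integral q m.+1 s g.
Proof.
move=> cf cg fg; have cb := @continuous_bump R N m.+1 s.
apply: le_cube_integral; [exact: continuous_mul|exact: continuous_mul|move=> x _].
have [xs|sx] := leP (sqnorm x) s.
  by apply: ler_wpM2l; [exact: pos_pow_ge0|exact: fg].
by rewrite /bump !pos_pow_eq0 ?mul0r// subr_le0 ltW.
Qed.

(** * Normalised means over balls *)

Definition bump_mass {R : realType} (N q m : nat) (s : R) : R :=
  bump_integral q m s (fun _ : 'rV[R]_N => 1).

(** For [s >= N + 1] the bump is at least 1 on the unit cube, where [|x|^2 <= N]. *)
Lemma bump_mass_gt0 {R : realType} (N q m : nat) (s : R) : (0 < q)%N -> N.+1%:R <= s ->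
  0 < bump_mass N q m s.
Proof.
move=> q0 sN; apply: (lt_le_trans ltr01); apply: cube_integral_ge1 => //.
- by apply: continuous_mul; [exact: continuous_bump|exact: continuous_cst].
- by move=> x _; rewrite mulr1 pos_pow_ge0.
move=> x x01; rewrite mulr1 /bump /pos_pow.
have sx : 1 <= s - sqnorm x.
  rewrite lerBrDr (le_trans _ sN)// -natr1 addrC lerD2r.
  rewrite [leRHS](_ : _ = \sum_(i < N) 1); last by rewrite sumr_const card_ord.
  by apply: ler_sum => i _; have /andP[x0 x1] := x01 i; exact: exprn_ile1.
by rewrite max_r ?(le_trans ler01)// exprn_ege1.
Qed.

Lemma laplacian_cst {R : realType} {N : nat} (c : R) :
  laplacian (fun _ : 'rV[R]_N => c) = fun=> 0.
Proof.
have d0 a i : partial i (fun _ : 'rV[R]_N => a) = fun=> 0.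
  by apply/funext => y; rewrite /partial; exact: derive_cst.
by apply/funext => x; rewrite /laplacian big1// => i _; rewrite !d0.
Qed.

(** [green_bump] for a constant function.  It stands in for the explicit value
    of the mass as a Beta-type integral times [s^(m + N / 2)]. *)
Lemma bump_mass_recurrence {R : realType} (N q m : nat) (s : R) : s <= q%:R ^+ 2 ->
  2 * m.+2%:R * s * bump_mass N q m.+1 s = (2 * m.+2%:R + N%:R) * bump_mass N q m.+2 s.
Proof.
move=> sq; have := green_bump q m s (fun _ : 'rV[R]_N => 1) (classC_cst 2 1) sq.
rewrite laplacian_cst {1}/bump_integral (_ : (fun x => _ * 0) = fun=> 0); last first.
  by apply/funext => x; rewrite mulr0.
rewrite cube_integral0 -!/(bump_mass N q _ s) => /esym e.
have m0 : (2 * m.+3%:R : R) != 0 by rewrite mulf_neq0.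
apply: (mulfI m0); apply/eqP; rewrite -subr_eq0 -[X in _ == X]e; apply/eqP; ring.
Qed.

(** Dividing by the mass, rather than by a power of [s], makes the mean of a
    constant exact and removes any dependence on [q] from one-sided bounds. *)
Definition bump_mean {R : realType} {N : nat} (q m : nat) (s : R) (f : 'rV[R]_N -> R) : R :=
  bump_integral q m s f / bump_mass N q m s.

Lemma le_bump_mean {R : realType} {N : nat} (q m : nat) (s : R) (f g : 'rV[R]_N -> R) :
  (0 < q)%N -> N.+1%:R <= s -> continuous f -> continuous g ->
  (forall x, sqnorm x <= s -> f x <= g x) ->
  bump_mean q m.+1 s f <= bump_mean q m.+1 s g.
Proof.
move=> q0 sN cf cg fg; apply: ler_wpM2r; last exact: le_bump_integral.
by rewrite invr_ge0 ltW ?bump_mass_gt0.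
Qed.

Lemma bump_mean_affine {R : realType} {N : nat} (q m : nat) (s a b : R)
    (f : 'rV[R]_N -> R) :
  (0 < q)%N -> N.+1%:R <= s -> continuous f ->
  bump_mean q m s (fun x => a * f x + b) = a * bump_mean q m s f + b.
Proof.
move=> q0 sN cf; have M0 := bump_mass_gt0 N q m s q0 sN.
have cb := @continuous_bump R N m s.
have e : bump_integral q m s (fun x => a * f x + b) = a * bump_integral q m s f + b * bump_mass N q m s.
  have cm := continuous_mul cb (@continuous_cst R N 1).
  rewrite -[X in _ = _ + X]cube_integral_scale// -[RHS]cube_integral_lin; last 2 first.
  - exact: continuous_mul.
  - exact: continuous_mul (continuous_cst _) cm.
  by congr cube_integral; apply/funext => x; ring.
by rewrite /bump_mean e mulrDl mulfK ?lt0r_neq0// mulrA.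
Qed.

Lemma bump_mean_cst {R : realType} {N : nat} (q m : nat) (s a : R) :
  (0 < q)%N -> N.+1%:R <= s -> bump_mean q m s (fun _ : 'rV[R]_N => a) = a.
Proof.
move=> q0 sN; rewrite -[RHS]add0r.
rewrite -(mul0r (bump_mean q m s (fun _ : 'rV[R]_N => 0))) -bump_mean_affine//.
  by congr bump_mean; apply/funext => x; rewrite mul0r add0r.
exact: continuous_cst.
Qed.

(** The quotient rule produces the integrals of [f] against the bumps of degrees
    [m.+1] and [m.+2].  Thanks to the mass recurrence their combination is the
    one that [green_bump] identifies with the integral of [laplacian f] against
    the bump of degree [m.+3]. *)
Lemma is_derive_bump_mean {R : realType} {N : nat} (q m : nat) (s : R)
    (f : 'rV[R]_N -> R) :
  (0 < q)%N -> N.+1%:R <= s -> s <= q%:R ^+ 2 -> classC 2 f ->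
  is_derive s 1 (fun s => bump_mean q m.+2 s f)
    (bump_mean q m.+3 s (laplacian f) / (2 * (2 * m.+3%:R + N%:R))).
Proof.
move=> q0 sN sq C2; have cf := classC_continuous C2.
have M k := bump_mass_gt0 N q k s q0 sN.
have s0 : 0 < s by rewrite (lt_le_trans _ sN).
have df := is_derive_bump_integral q m s f cf.
have dc := is_derive_bump_integral q m s _ (@continuous_cst R N 1).
have dV := is_deriveV (lt0r_neq0 (M m.+2)) dc.
have D := is_deriveM df dV.
apply: (is_derive_congr D); first by [].
rewrite /GRing.scale /= [bump_mean _ _ _ _ in RHS]/bump_mean green_bump// -/(bump_mass N q m.+1 s).
have r1 := bump_mass_recurrence N q m s sq.
have r2 := bump_mass_recurrence N q m.+1 s sq.
have := M m.+2; have := ltr0Sn R m.+2; have := ltr0Sn R m.+1; have : 0 <= N%:R :> R by [].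
move: (bump_mass N q m.+1 s) (bump_mass N q m.+2 s) (bump_mass N q m.+3 s) r1 r2 => c1 c2 c3.
move: (bump_integral _ _ _ _) (bump_integral _ _ _ _) => F2 F1.
(* all that is left is rational arithmetic in the two recurrences *)
move: (m.+2%:R) (m.+3%:R) (N%:R) => a b n r1 r2 n0 a0 b0 c20.
have -> : c1 = (2 * a + n) * c2 / (2 * a * s) by rewrite -r1; field; rewrite !gt_eqF.
have -> : c3 = 2 * b * s * c2 / (2 * b + n) by rewrite r2; field; rewrite gt_eqF//; lra.
field; rewrite !gt_eqF//; lra.
Qed.

(** * Nonexistence *)

(** [2 / T - t / T^2] is the tangent at [T] of the convex
    function [1 / t].  For [t >= 1] use [t^(-p) >= 1 / t]; for [t <= 1] use
    [t^(-p) >= 1 >= 2 / T].  Being affine in [t], the bound can be averaged. *)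
Lemma powR_ge_tangent {R : realType} (p t T : R) : 0 < p -> p <= 1 -> 0 < t -> 2 <= T ->
  2 / T - t / T ^+ 2 <= t `^ (- p).
Proof.
move=> p0 p1 t0 T2; have T0 : 0 < T by lra.
have [t1|/ltW t1] := leP 1 t.
  apply: (@le_trans _ _ t^-1).
    rewrite -(@ler_pM2r _ (t * T ^+ 2)) ?mulr_gt0 ?exprn_gt0//.
    have -> : (2 / T - t / T ^+ 2) * (t * T ^+ 2) = 2 * t * T - t ^+ 2.
      by field; rewrite gt_eqF.
    have -> : t^-1 * (t * T ^+ 2) = T ^+ 2 by field; rewrite gt_eqF.
    by rewrite -subr_ge0 (_ : _ - _ = (T - t) ^+ 2) ?sqr_ge0//; ring.
  by rewrite -(powR_inv1 (ltW t0)); apply: ler_powR => //; rewrite lerN2.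
apply: (@le_trans _ _ 1).
  have h1 : 2 / T <= 1 by rewrite ler_pdivrMr ?mul1r.
  have h2 : 0 <= t / T ^+ 2 by rewrite divr_ge0 ?exprn_ge0 ?ltW.
  lra.
rewrite powRN invf_ge1 ?powR_gt0//.
have <- : 1 `^ p = 1 :> R by rewrite powR1.
by apply: ge0_ler_powR => //; rewrite ?nnegrE ltW.
Qed.

Lemma derive_le_increment {R : realType} (f df : R -> R) (a b c : R) : a <= b ->
  (forall s, a <= s -> s <= b -> is_derive s 1 f (df s)) ->
  (forall s, a <= s -> s <= b -> df s <= c) ->
  f b <= f a + c * (b - a).
Proof.
move=> ab fdf dfc.
have [s| |s] := @MVT_segment _ f df a b ab.
- by rewrite in_itv /= => /andP[/ltW ? /ltW ?]; exact: fdf.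
- apply: derivable_within_continuous => s; rewrite in_itv /= => /andP[? ?].
  by have [] := fdf s.
rewrite in_itv /= => /andP[as_ sb] e; rewrite -lerBlDl e.
by apply: ler_wpM2r; rewrite ?subr_ge0// dfc.
Qed.

(** Here [A m] is the mean for the bump of degree [m.+2], the derivative
    formula being available from degree 2 on, and [al m] is the constant in that
    formula.  The radii [s0 <= s1 <= s2] and the bounds [Cu],
    [Cv], [K] are chosen before the cube [q], so that the means can be followed
    up to [s2]. *)
Theorem theorem1p3 (R : realType) (N : nat) (p : R)
    (hN : (1 <= N)%N) (hp0 : 0 < p) (hp1 : p <= 1) :
  ~ exists u : 'rV[R]_N -> R,
      [/\ classC 4 u,
          forall x : 'rV[R]_N, 0 < u x
        & forall x : 'rV[R]_N, bilaplacian u x = - (u x `^ (- p))].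
Proof.
move=> [u [C4 u0 eq]].
pose v := laplacian u.
have C2v : classC 2 v by exact: classC_laplacian.
have C2u : classC 2 u by do 2 apply: classC_weaken.
have cu := classC_continuous C2u.
have cv := classC_continuous C2v.
have cw : continuous (laplacian v) by apply: (classC_continuous (k := 0)); exact: classC_laplacian.
have cc (c : R) := @continuous_cst R N c.
pose s0 : R := N.+1%:R.
have s01 : 1 <= s0 by rewrite ler1n.
have s0p : 0 < s0 by rewrite (lt_le_trans ltr01).
have sub (x : 'rV[R]_N) : sqnorm x <= s0 -> cube N.+1 x.
  move=> xs i; rewrite -ler_sqr ?nnegrE// real_normK ?num_real//.
  apply: (@le_trans _ _ s0); last by rewrite expr2 ler_peMr// (le_trans _ s01).
  apply: le_trans xs; rewrite /sqnorm (bigD1 i)//= lerDl sumr_ge0// => j _; exact: sqr_ge0.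
have [Cu Cu0 uC] := continuous_cube_bounded N.+1 u cu.
have [Cv Cv0 vC] := continuous_cube_bounded N.+1 v cv.
have uC0 x : sqnorm x <= s0 -> u x <= Cu.
  by move=> xs; exact: le_trans (ler_norm _) (uC _ (sub _ xs)).
have vC0 x : sqnorm x <= s0 -> v x <= Cv.
  by move=> xs; exact: le_trans (ler_norm _) (vC _ (sub _ xs)).
pose K := 2 + Cu + Cv.
pose al (m : nat) : R := 2 * (2 * m.+3%:R + N%:R).
have al1 m : 1 <= al m.
  rewrite /al; have : 1 <= m.+3%:R :> R by rewrite ler1n.
  have : 0 <= N%:R :> R by []; lra.
have al0 m : 0 < al m by rewrite (lt_le_trans ltr01).
have K2 : 2 <= K by rewrite /K -addrA lerDl addr_ge0.
(* the rate at which [A 1 s v] decreases against [ln s] *)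
pose c := (al 1 * K)^-1.
have c0 : 0 < c by rewrite invr_gt0 mulr_gt0//; lra.
(* at [s1] the bound [Cv - c * (ln s1 - ln s0)] equals [-1] *)
pose s1 := s0 * expR ((Cv + 1) / c).
have s10 : s0 <= s1.
  rewrite /s1 ler_peMr ?(le_trans ler01)// -[leLHS]expR0 ler_expR.
  by rewrite divr_ge0 ?(ltW c0)// addr_ge0.
(* [A 0 s u <= K * s1] at [s1], and from there on it loses [1 / al 0] per unit *)
pose s2 := s1 + al 0 * (K * s1 + 1).
have s21 : s1 <= s2.
  by rewrite lerDl mulr_ge0 ?ltW// addr_gt0// mulr_gt0//; lra.
pose q := maxn N.+1 (Num.trunc s2).+1.
have q0 : (0 < q)%N by rewrite leq_max.
have s2q : s2 <= q%:R ^+ 2.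
  apply: (@le_trans _ _ q%:R); last by rewrite expr2 ler_peMr// ler1n.
  by rewrite (le_trans (ltW (truncnS_gt _)))// ler_nat leq_maxr.
pose A m s (f : 'rV[R]_N -> R) := bump_mean q m.+2 s f.
have dA m s f : s0 <= s -> s <= s2 -> classC 2 f ->
    is_derive s 1 (fun s => A m s f) (A m.+1 s (laplacian f) / al m).
  by move=> ss0 ss2; apply: is_derive_bump_mean => //; exact: le_trans s2q.
have A_cst m s a : s0 <= s -> A m s (fun=> a) = a.
  by move=> ss0; exact: bump_mean_cst.
have A_le m s a f : s0 <= s -> continuous f ->
    (forall x, sqnorm x <= s -> f x <= a) -> A m s f <= a.
  by move=> ss0 cf fa; rewrite -[leRHS](A_cst m s a ss0); apply: le_bump_mean.
have lapv x : laplacian v x = - (u x `^ (- p)) by exact: eq.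
(* [v] is superharmonic, so its means decrease *)
have Av m s : s0 <= s -> s <= s2 -> A m s v <= Cv.
  move=> ss0 ss2.
  have := @derive_le_increment R (fun s => A m s v)
    (fun s => A m.+1 s (laplacian v) / al m) s0 s 0 ss0.
  rewrite mul0r addr0 => H; apply: (le_trans (H _ _)).
  - by move=> t t0 ts; apply: dA => //; exact: le_trans ts ss2.
  - move=> t t0 ts; rewrite pmulr_lle0 ?invr_gt0//; apply: A_le => // x _.
    by rewrite lapv oppr_le0 powR_ge0.
  - exact: A_le m s0 Cv v (lexx _) cv vC0.
have Au m s : s0 <= s -> s <= s2 -> A m s u <= K * s.
  move=> ss0 ss2.
  have := @derive_le_increment R (fun s => A m s u)
    (fun s => A m.+1 s v / al m) s0 s Cv ss0.
  move=> H; apply: (le_trans (H _ _)).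
  - by move=> t t0 ts; apply: dA => //; exact: le_trans ts ss2.
  - move=> t t0 ts; rewrite ler_pdivrMr//; apply: le_trans (Av _ _ t0 (le_trans ts ss2)) _.
    by rewrite ler_peMr.
  have : A m s0 u <= Cu := A_le m s0 Cu u (lexx _) cu uC0.
  have : Cu <= Cu * s by rewrite ler_peMr//; lra.
  have : 0 <= Cv * s0 by rewrite mulr_ge0//; lra.
  rewrite /K mulrBr !mulrDl; lra.
(* average the affine lower bound for [u^(-p)] at [T = K * s >= A m s u] *)
have Aw m s : s0 <= s -> s <= s2 -> A m s (laplacian v) <= - (K * s)^-1.
  move=> ss0 ss2; set T := K * s.
  have T2 : 2 <= T by rewrite (le_trans K2)// ler_peMr//; lra.
  have T0 : 0 < T by lra.
  apply: (@le_trans _ _ (A m s (fun x => T ^- 2 * u x + - (2 / T)))).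
    apply: le_bump_mean => //.
      exact: continuous_add (continuous_mul (cc _) cu) (cc _).
    by move=> x _; rewrite lapv; have := powR_ge_tangent p (u x) T hp0 hp1 (u0 x) T2; lra.
  rewrite [A _ _ _]bump_mean_affine//.
  apply: (@le_trans _ _ (T ^- 2 * T - 2 / T)).
    by rewrite lerD2r; apply: ler_wpM2l; [rewrite invr_ge0 exprn_ge0// ltW|exact: Au].
  by rewrite le_eqVlt; apply/orP; left; apply/eqP; field; rewrite gt_eqF.
have Av1 s : s1 <= s -> s <= s2 -> A 1 s v <= -1.
  move=> ss1 ss2; have ss0 := le_trans s10 ss1.
  have := @derive_le_increment R (fun s => A 1 s v + c * ln s)
    (fun s => A 2 s (laplacian v) / al 1 + c * s^-1) s0 s 0 ss0.
  rewrite mul0r addr0 => H.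
  have : A 1 s v + c * ln s <= A 1 s0 v + c * ln s0.
    apply: H => t t0 ts; have ts2 := le_trans ts ss2.
      have dln := is_deriveZ c (is_derive1_ln (lt_le_trans s0p t0)).
      exact: is_derive_congr (is_deriveD (dA 1 t v t0 ts2 C2v) dln) erefl erefl.
    have := Aw 2 t t0 ts2; rewrite -(ler_pM2r (_ : 0 < (al 1)^-1)) ?invr_gt0// => h.
    have e : - (K * t)^-1 / al 1 = - (c * t^-1) by rewrite /c mulNr -!invfM; congr (- _^-1); ring.
    rewrite e in h; lra.
  have l1 : ln s0 + (Cv + 1) / c <= ln s.
    have -> : ln s0 + (Cv + 1) / c = ln s1 by rewrite /s1 lnM ?posrE ?expR_gt0 ?expRK//; lra.
    by rewrite ler_ln// posrE; lra.
  have : c * (ln s0 + (Cv + 1) / c) <= c * ln s by rewrite ler_pM2l.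
  rewrite mulrDr mulrCA divff ?gt_eqF// mulr1.
  have := Av 1 s0 (lexx _) (le_trans ss0 ss2); lra.
have : A 0 s2 u <= A 0 s1 u + - (al 0)^-1 * (s2 - s1).
  apply: (@derive_le_increment R (fun s => A 0 s u) (fun s => A 1 s v / al 0)) => // t t0 ts.
    by apply: dA => //; exact: le_trans t0.
  by rewrite -mulN1r; apply: ler_wpM2r; rewrite ?invr_ge0 ?(ltW (al0 0))// Av1.
have -> : - (al 0)^-1 * (s2 - s1) = - (K * s1 + 1) by rewrite /s2; field; rewrite gt_eqF.
have := Au 0 s1 s10 s21.
have : 0 <= A 0 s2 u.
  have ss0 := le_trans s10 s21.
  by rewrite -[leLHS](A_cst 0 s2 0 ss0); apply: le_bump_mean => // x _; exact: ltW.
lra.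
Qed.
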